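(* Let $m\ge1$. The set $\{F_{\mathbf c}\mid \mathbf c\in\mathrm{MComp}\}$ of fundamental multi-quasisymmetric functions is a $\mathbf k$-basis of the $\mathbf k$-module $\mathrm{MQSym}$ of multi-quasisymmetric functions.
   Context: $\mathbf k$ is a commutative unitary ring containing $\mathbb Q$; $m$ is a fixed positive integer, $[m]=\{1,\dots,m\}$, $\mathbb N=\{0,1,2,\dots\}$, $\mathbb P=\{1,2,\dots\}$. Let $X=\{x_{i,j}\mid i\in[m], j\in\mathbb P\}$ be mutually commuting variables and $\mathbf k[[X]]$ the algebra of formal power series in $X$. A multi-composition (or $[m]$-composition) of length $k$ is a matrix in $\mathbb N^{m\times k}$ all of whose columns are nonzero; the empty multi-composition of length $0$ is included. $\mathrm{MComp}$ is the set of all multi-compositions. For $w=(a_1,\dots,a_m)\in\mathbb N^m$ and $j\in\mathbb P$ put $x_j^w:=x_{1,j}^{a_1}\cdots x_{m,j}^{a_m}$. A formal power series $f\in\mathbf k[[X]]$ of bounded degree is a multi-quasisymmetric function if for each multi-composition $(w_1,\dots,w_k)$ the coefficients in $f$ of the monomials $x_{j_1}^{w_1}\cdots x_{j_k}^{w_k}$ are equal for all integers $1\le j_1<\cdots<j_k$. $\mathrm{MQSym}$ is the set of all of them. For $\mathbf c=(\mathbf c_1,\dots,\mathbf c_k)=(a_{i,j})\in\mathrm{MComp}$ let $|\mathbf c_i|=\sum_{j=1}^m a_{j,i}$, $|\mathbf c|=\sum_{i=1}^k|\mathbf c_i|$, and $\mathrm{SN}(\mathbf c)=\{|\mathbf c_1|,|\mathbf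 c_1|+|\mathbf c_2|,\dots,\sum_{i=1}^{k-1}|\mathbf c_i|\}$ (empty if $k\leq 1$). For $j\in\{1,\dots,|\mathbf c|\}$ there are unique $0\le r_j\le k-1$ and $1\le \ell_j\le m$ with $\sum_{p=1}^{r_j}|\mathbf c_p|+\sum_{q=1}^{\ell_j-1}a_{q,r_j+1}<j\le\sum_{p=1}^{r_j}|\mathbf c_p|+\sum_{q=1}^{\ell_j}a_{q,r_j+1}$; set $g_{\mathbf c}(j):=\ell_j$. (So $g_{\mathbf c}(1),g_{\mathbf c}(2),\dots$ lists row indices, reading the columns left to right and each column top to bottom, row $q$ of column $i$ being repeated $a_{q,i}$ times.) With $n=|\mathbf c|$, the fundamental multi-quasisymmetric function of index $\mathbf c$ is $$F_{\mathbf c}=\sum_{\substack{1\le i_1\le i_2\le\cdots\le i_n\\ i_k<i_{k+1}\text{ if }k\in\mathrm{SN}(\mathbf c)}}\ \prod_{j=1}^{n}x_{g_{\mathbf c}(j),\,i_j},$$ with $F_{\mathbf c}=1$ for $\mathbf c$ empty. *)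

(* Defs.v *)
From HB Require Import structures.
From mathcomp Require Import all_boot all_order all_algebra finmap.
From mathcomp Require Import monalg.
From mathcomp Require Import boolp classical_sets functions cardinality fsbigop.

Set Implicit Arguments.
Unset Strict Implicit.
Unset Printing Implicit Defensive.

Import GRing.Theory.

Local Open Scope ring_scope.

(* Formal power series over k in the variables X, as coefficient functions on
   the commutative monomials.  Only the k-module structure is declared: the
   pointwise product that functions also carry is not the product of series. *)
Definition pseries (k : comNzRingType) (X : choiceType) : Type :=
  {cmonom X} -> k^o.

HB.instance Definition _ (k : comNzRingType) (X : choiceType) :=
  GRing.Lmodule.copy (pseries k X) ({cmonom X} -> k^o).

Definition monomial_series (k : comNzRingType) (X : choiceType)
    (u : {cmonom X}) : pseries k X :=
  fun v => (v == u)%:R.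

(* The pair (i, j) stands for x_{i+1,j+1}: the second index ranges over
   {1, 2, ...} in the source and over nat here, with the same order. *)
Definition mvar (m : nat) : choiceType := ('I_m * nat)%type.

Section MultiCompositions.
Variable m : nat.

Definition nonzero_columns (A : {l : nat & 'M[nat]_(m, l)}) : bool :=
  [forall i, col i (tagged A) != 0].

Record mcomp := MComp {
  mcomp_val :> {l : nat & 'M[nat]_(m, l)};
  _ : nonzero_columns mcomp_val }.

HB.instance Definition _ := [isSub for mcomp_val].
HB.instance Definition _ := [Choice of mcomp by <:].

Definition mlen (c : mcomp) : nat := tag (mcomp_val c).
Definition mmx (c : mcomp) : 'M[nat]_(m, mlen c) := tagged (mcomp_val c).

Definition colwt (c : mcomp) (i : 'I_(mlen c)) : nat :=
  (\sum_(q < m) mmx c q i)%N.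

Definition mwt (c : mcomp) : nat := (\sum_(i < mlen c) colwt i)%N.

Definition SN (c : mcomp) : seq nat :=
  [seq (\sum_(i < mlen c | (i < r)%N) colwt i)%N | r <- iota 1 (mlen c).-1].

Definition gword (c : mcomp) : seq 'I_m :=
  flatten [seq flatten [seq nseq (mmx c q i) q | q <- enum 'I_m]
          | i <- enum 'I_(mlen c)].

Lemma size_gword (c : mcomp) : size (gword c) == mwt c.
Proof.
rewrite /gword size_flatten /shape -map_comp sumnE big_map big_enum /=.
apply/eqP/eq_bigr => i _.
rewrite size_flatten /shape -map_comp sumnE big_map big_enum /=.
by apply: eq_bigr => q _; rewrite size_nseq.
Qed.

(* g c j is g_c(j+1), see gP. *)
Definition g (c : mcomp) (j : 'I_(mwt c)) : 'I_m :=
  tnth (Tuple (size_gword c)) j.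

Let nth_flatten_split (T : Type) (x0 : T) (ss : seq (seq T)) j :
  (j < size (flatten ss))%N ->
  exists r, [/\ (r < size ss)%N,
    (sumn (shape (take r ss)) <= j
       < sumn (shape (take r ss)) + size (nth [::] ss r))%N &
    nth x0 (flatten ss) j
      = nth x0 (nth [::] ss r) (j - sumn (shape (take r ss)))].
Proof.
elim: ss j => [//|s ss IH] j /=; rewrite size_cat nth_cat => hj.
case: ltnP => js; first by exists 0%N; rewrite /= subn0 add0n js.
have /IH[r [h1 /andP[h2 h3] h4]] : (j - size s < size (flatten ss))%N.
  by rewrite ltn_subLR.
exists r.+1; split => //=; last by rewrite h4 subnDA.
by rewrite -leq_subRL // h2 -addnA -ltn_subLR.
Qed.

Let sum_take (n : nat) (F : 'I_n -> nat) r : (r <= n)%N ->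
  sumn (map F (take r (enum 'I_n))) = (\sum_(i < n | (i < r)%N) F i)%N.
Proof.
move=> rn; rewrite sumnE big_map.
have -> : take r (enum 'I_n) = filter (fun i : 'I_n => (i < r)%N) (enum 'I_n).
  apply: (inj_map val_inj); rewrite map_take val_enum_ord take_iota.
  rewrite (minn_idPl rn) -(filter_map val (fun i => i < r)%N) val_enum_ord.
  rewrite -[in RHS](subnKC rn) iotaD filter_cat add0n.
  have -> : [seq i <- iota 0 r | (i < r)%N] = iota 0 r.
    by apply/all_filterP/allP => i; rewrite mem_iota.
  rewrite (_ : [seq _ <- iota r _ | _] = [::]) ?cats0 //.
  apply/eqP; rewrite -(negbK (_ == _)) -has_filter; apply/hasPn => i.
  by rewrite mem_iota -leqNgt => /andP[].
by rewrite big_filter big_enum_cond.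
Qed.

(* The inequalities characterizing g_c, with j shifted by one. *)
Lemma gP (c : mcomp) (j : 'I_(mwt c)) :
  exists r : 'I_(mlen c),
    (\sum_(p < mlen c | (p < r)%N) colwt p
       + \sum_(q < m | (q < g j)%N) mmx c q r <= j
     < \sum_(p < mlen c | (p < r)%N) colwt p
       + \sum_(q < m | (q <= g j)%N) mmx c q r)%N.
Proof.
have jw : (j < size (gword c))%N by rewrite (eqP (size_gword c)).
have x0 : 'I_m by case: (gword c) jw.
rewrite /g (tnth_nth x0) /=.
have [r [r1 r2 ->]] := nth_flatten_split x0 jw.
move: r1 r2; rewrite size_map size_enum_ord => rl.
have i0 : 'I_(mlen c) by exists r.
rewrite (nth_map i0) ?size_enum_ord // -map_take /shape -map_comp.
rewrite (@eq_map _ _ _ (@colwt c)); last first.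
  move=> i /=; rewrite size_flatten /shape -map_comp sumnE big_map big_enum /=.
  by apply: eq_bigr => q _; rewrite size_nseq.
have -> : nth i0 (enum 'I_(mlen c)) r = Ordinal rl.
  by apply: val_inj; rewrite /= nth_enum_ord.
rewrite (sum_take _ (ltnW rl)) => /andP[r2 r3].
exists (Ordinal rl) => /=; set S := (\sum_(p < _ | _) _)%N in r2 r3 *.
have /(nth_flatten_split x0) : (j - S < size (flatten
    [seq nseq (mmx c q (Ordinal rl)) q | q <- enum 'I_m]))%N.
  by rewrite ltn_subLR.
move=> [q [q1 q2 ->]]; move: q1 q2.
rewrite size_map size_enum_ord => qm.
rewrite (nth_map x0) ?size_enum_ord // -map_take /shape -map_comp.
rewrite (@eq_map _ _ _ (fun q => mmx c q (Ordinal rl))); last first.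
  by move=> i /=; rewrite size_nseq.
have -> : nth x0 (enum 'I_m) q = Ordinal qm.
  by apply: val_inj; rewrite /= nth_enum_ord.
rewrite (sum_take _ (ltnW qm)) size_nseq.
move=> /andP[q2 q3]; rewrite nth_nseq ltn_subLR // q3 /=.
rewrite -leq_subRL // q2 /= -ltn_subLR //.
rewrite (bigD1 (Ordinal qm)) //= addnC.
rewrite (eq_bigl (fun i : 'I_m => (i < q)%N)) // => i.
by rewrite ltn_neqAle andbC.
Qed.

(* x_j^w for a column w *)
Definition xpow (w : 'cV[nat]_m) (j : nat) : {cmonom (mvar m)} :=
  \big[mmul/mone]_(q < m) expcmn (@ucm (mvar m) (q, j)) (w q 0).

Definition mcomp_monomial (c : mcomp) (j : (mlen c).-tuple nat) :
    {cmonom (mvar m)} :=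
  \big[mmul/mone]_(s < mlen c) xpow (col s (mmx c)) (tnth j s).

End MultiCompositions.

Section MQSym.
Variables (k : comNzRingType) (m : nat).

Definition bounded_degree (f : pseries k (mvar m)) : Prop :=
  exists d : nat, forall u, (d < mdeg u)%N -> f u = 0.

Definition multi_quasisymmetric (f : pseries k (mvar m)) : Prop :=
  bounded_degree f /\
  forall (w : mcomp m) (j j' : (mlen w).-tuple nat),
    sorted ltn j -> sorted ltn j' ->
    f (mcomp_monomial j) = f (mcomp_monomial j').

Definition MQSym : {pred pseries k (mvar m)} :=
  fun f => `[< multi_quasisymmetric f >].

Lemma MQSym_submod_closed : GRing.subsemimod_closed MQSym.
Proof.
split; first split.
- by apply/asboolP; split => //; exists 0%N.
- move=> f h /asboolP[[d fd] fq] /asboolP[[e he] hq]; apply/asboolP; split.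
    exists (maxn d e) => u; rewrite gtn_max => /andP[du eu].
    by rewrite /GRing.add /= fd // he // addr0.
  by move=> w j j' sj sj'; rewrite /GRing.add /= (fq _ j j') // (hq _ j j').
- move=> a f /asboolP[[d fd] fq]; apply/asboolP; split.
    by exists d => u du; rewrite /GRing.scale /= fd // scaler0.
  by move=> w j j' sj sj'; rewrite /GRing.scale /= (fq _ j j').
Qed.

HB.instance Definition _ :=
  GRing.isSubmodClosed.Build k (pseries k (mvar m)) MQSym MQSym_submod_closed.

(* The sequences 1 <= i_1 <= ... <= i_n with i_r < i_{r+1} for r in SN c; the
   entry i_r is nth 0 i r.-1. *)
Definition fundamental_indices (c : mcomp m) : set ((mwt c).-tuple nat) :=
  [set i | forall r : nat, (0 < r < mwt c)%N ->
     (nth 0%N i r.-1 <= nth 0%N i r)%N /\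
     (r \in SN c -> (nth 0%N i r.-1 < nth 0%N i r)%N)].

Arguments fundamental_indices : clear implicits.

Definition fundamental_monomial (c : mcomp m) (i : (mwt c).-tuple nat) :
    {cmonom (mvar m)} :=
  \big[mmul/mone]_(j < mwt c) ucm (g j, tnth i j).

Lemma fundamental_monomial_finite (c : mcomp m) (u : {cmonom (mvar m)}) :
  finite_set [set i : (mwt c).-tuple nat | fundamental_monomial i = u].
Proof.
pose N := (\max_(p <- finsupp u) p.2)%N.
pose h (t : (mwt c).-tuple 'I_N.+1) : (mwt c).-tuple nat := map_tuple val t.
apply: (@sub_finite_set _ _ (range h)); last exact/finite_image/finite_finset.
move=> i /= iu.
have iN j : (tnth i j < N.+1)%N.
  have : (g j, tnth i j) \in finsupp u.
    rewrite -iu /fundamental_monomial (bigD1 j) //= mem_finsupp cmM cmUU.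
    by rewrite addn_eq0.
  move=> hu; rewrite ltnS /N.
  by rewrite (big_rem _ hu) leq_maxl.
exists [tuple inord (tnth i j) | j < mwt c] => //.
by apply: eq_from_tnth => j; rewrite tnth_map tnth_mktuple [LHS]inordK.
Qed.

(* The infinite sum is taken coefficientwise; by fundamental_monomial_finite
   each coefficient is a sum with finite support. *)
Definition fundamental (c : mcomp m) : pseries k (mvar m) :=
  fun u => \sum_(i \in fundamental_indices c)
             monomial_series k (fundamental_monomial i) u.

End MQSym.

Arguments fundamental_indices {m} c.
Arguments fundamental k {m} c.
Arguments MQSym k m : clear implicits.

(* Stated for an indexed family, so the F i are also pairwise distinct. *)
Definition is_basis (k : comNzRingType) (V : lmodType k) (S : submodClosed V)
    (I : choiceType) (F : I -> V) : Prop :=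
  [/\ forall i, F i \in S,
      forall (s : seq I) (a : I -> k), uniq s ->
        \sum_(i <- s) a i *: F i = 0 -> {in s, forall i, a i = 0}
    & forall v, v \in S ->
        exists (s : seq I) (a : I -> k), v = \sum_(i <- s) a i *: F i].

(* Main.v *)
Require Import Defs.
From mathcomp Require Import all_boot all_order all_algebra finmap.
From mathcomp Require Import monalg.
From mathcomp Require Import boolp classical_sets fsbigop.

(** A monomial is a multiset of pairs (row, index).  Sorting these pairs by
    index and then by row gives the same biword whether the monomial is read
    from a multi-composition d placed at indices j_1 < ... < j_l, or as a term
    of F_c, because the word g_c increases weakly inside each column of c.
    Hence the coefficient of F_c at d is 1 if g_c = g_d and SN(c) is contained
    in SN(d), and 0 otherwise.  This relation forces d to have at least as many
    columns as c, with equality only if c = d, so the matrix of coefficients is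
    unitriangular for the number of columns; freeness and spanning follow by
    induction on that number, each f in MQSym involving only the finitely many
    multi-compositions of weight at most its degree. *)

Set Implicit Arguments.
Unset Strict Implicit.
Unset Printing Implicit Defensive.

Import GRing.Theory.

(** * Proper partial sums of a list of block sizes *)

Definition cuts (sh : seq nat) : seq nat :=
  [seq sumn (take r sh) | r <- iota 1 (size sh).-1].

Lemma cuts_cons2 a b sh :
  cuts [:: a, b & sh] = a :: map (addn a) (cuts (b :: sh)).
Proof. by rewrite /cuts /= addn0 (iotaDl 1 1) -!map_comp. Qed.

(** The form used in inductions over blocks: [sh != [::]] excludes the full sum, and [a <= r] guards
    the truncated [r - a]. *)
Lemma mem_cuts_cons a sh r :
  (r \in cuts (a :: sh)) =
  [&& sh != [::], a <= r & (r == a) || (r - a \in cuts sh)].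
Proof.
case: sh => [|b sh] //; rewrite cuts_cons2 inE /=.
have [->|ra] /= := eqVneq r a; first by rewrite leqnn.
have [ar|ar] := leqP a r.
  by rewrite -{1}(subnKC ar) mem_map //; apply: addnI.
by apply/negbTE/mapP => -[y _ ry]; rewrite ry ltnNge leq_addr in ar.
Qed.

Lemma cuts_sorted sh : all (ltn 0) sh -> sorted ltn (cuts sh).
Proof.
elim: sh => [|a [|b sh] IH] // /andP[a0 sh0].
rewrite cuts_cons2 /= path_sortedE; last exact: ltn_trans.
apply/andP; split; last first.
  rewrite sorted_map (@eq_sorted _ _ ltn) ?IH // => x y /=.
  by rewrite ltn_add2l.
rewrite all_map; apply/allP => r /mapP[[|q]]; rewrite mem_iota // => _ ->.
case/andP: sh0 => b0 _.
by rewrite /= -[X in (X < _)]addn0 ltn_add2l ltn_addr.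
Qed.

Lemma cuts_range sh r : all (ltn 0) sh -> r \in cuts sh -> 0 < r < sumn sh.
Proof.
elim: sh r => [|a sh IH] r // /andP[/= a0 sh0].
rewrite mem_cuts_cons => /and3P[shn ar /orP[/eqP->|/(IH _ sh0)/andP[_ rs]]] /=.
  case: sh shn sh0 {IH} => //= b sh _ /andP[/= b0 _].
  by rewrite a0 -[X in X < _]addn0 ltn_add2l ltn_addr.
by rewrite (leq_trans a0 ar) -ltn_subLR.
Qed.

(** Entries are differences of consecutive partial sums; the equal totals supply the last one, which
    [cuts] omits. *)
Lemma cuts_inj sh sh' : size sh = size sh' -> sumn sh = sumn sh' ->
  cuts sh = cuts sh' -> sh = sh'.
Proof.
move=> sz ss' eq_cuts.
have eq_take r : (r <= size sh) -> sumn (take r sh) = sumn (take r sh').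
  case: r => [|r]; first by rewrite !take0.
  rewrite leq_eqVlt => /predU1P[->|rs]; first by rewrite {2}sz !take_size.
  have rs' : (r < (size sh).-1) by rewrite ltn_predRL.
  have := congr1 (fun s => nth 0%N s r) eq_cuts.
  by rewrite /cuts -sz !(nth_map 0%N) ?size_iota // nth_iota.
apply: (@eq_from_nth _ 0%N) => // i ish.
have := eq_take _ ish; rewrite !(take_nth 0%N) -?sz // -!cats1 !sumn_cat.
by rewrite eq_take 1?ltnW //= !addn0 => /addnI.
Qed.

Lemma cuts_subset_size sh sh' : all (ltn 0) sh ->
  {subset cuts sh <= cuts sh'} -> (size sh).-1 <= (size sh').-1.
Proof.
move=> sh0 /(uniq_leq_size (sorted_uniq ltn_trans ltnn (cuts_sorted sh0))).
by rewrite !size_map !size_iota.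
Qed.

(** The two lists of cuts are strictly increasing and equally long, so inclusion makes them equal,
    and [cuts_inj] applies. *)
Lemma cuts_subset_eq sh sh' : all (ltn 0) sh -> all (ltn 0) sh' ->
  size sh = size sh' -> sumn sh = sumn sh' ->
  {subset cuts sh <= cuts sh'} -> sh = sh'.
Proof.
move=> sh0 sh0' sz sm sub; apply: cuts_inj => //.
apply: (irr_sorted_eq ltn_trans ltnn); rewrite ?cuts_sorted //.
have := uniq_min_size (sorted_uniq ltn_trans ltnn (cuts_sorted sh0)) sub.
by rewrite !size_map !size_iota sz leqnn => /(_ isT)[].
Qed.

(** When [r.+1] is not a cut, positions [r] and [r.+1] lie in the same block. *)
Lemma flatten_step (T : eqType) (e : rel T) (x0 : T) (ss : seq (seq T)) r :
  all (sorted e) ss -> (r.+1 < size (flatten ss)) ->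
  r.+1 \notin cuts (shape ss) ->
  e (nth x0 (flatten ss) r) (nth x0 (flatten ss) r.+1).
Proof.
elim: ss r => [|w ss IH] r //= /andP[sw sss].
rewrite size_cat mem_cuts_cons !nth_cat => rlt.
have [rw|wr] := ltnP r.+1 (size w).
  by rewrite (ltnW rw) => _; move/(sortedP x0): sw; apply.
have ss0 : shape ss != [::].
  by case: ss rlt {IH sss} => //=; rewrite addn0 ltnNge wr.
rewrite ss0 /= negb_or => /andP[rNw rNss].
have {rNw}wr' : (size w <= r) by rewrite -ltnS ltn_neqAle wr eq_sym rNw.
rewrite ltnNge wr' /= subSn //; apply: IH; rewrite -?subSn //.
by rewrite leq_subLR.
Qed.

(** * Index words constant on blocks *)

Definition spread (sh js : seq nat) : seq nat :=
  flatten [seq nseq p.1 p.2 | p <- zip sh js].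

Lemma size_spread sh js : size sh = size js -> size (spread sh js) = sumn sh.
Proof.
elim: sh js => [|a sh IH] [|j js] // [sz].
by rewrite /spread /= size_cat size_nseq -/(spread sh js) IH.
Qed.

(** The index is constant inside a block, and at a cut it moves on to the next, strictly larger,
    entry of [js]. *)
Lemma spread_step sh js r : all (ltn 0) sh -> size sh = size js ->
  sorted ltn js -> (r.+1 < sumn sh) ->
  (nth 0 (spread sh js) r <= nth 0 (spread sh js) r.+1) /\
  (nth 0 (spread sh js) r < nth 0 (spread sh js) r.+1)
    = (r.+1 \in cuts sh).
Proof.
elim: sh js r => [|a sh IH] [|j js] //= r /andP[a0 sh0] [sz] sj rlt.
rewrite /spread /= -/(spread sh js) !nth_cat !size_nseq mem_cuts_cons.
have [ra|ar] := ltnP r.+1 a.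
  by rewrite (ltnW ra) !nth_nseq (ltnW ra) ra ltnn andbF.
have shn : sh != [::].
  by case: sh rlt {IH sh0 sz} => //=; rewrite addn0 ltnNge ar.
rewrite shn /=.
(* If [r < a], then [r] is the last position of the first block and [r.+1 = a] is a cut. *)
have [ra|ra] := ltnP r a.
  have -> : r.+1 = a by apply/eqP; rewrite eqn_leq ra ar.
  rewrite eqxx /= nth_nseq ra subnn.
  case: sh js sz sj sh0 shn {IH rlt} => [|b sh] [|j' js] //= _ /andP[jj' _].
  move=> /andP[b0 _] _.
  rewrite /spread /= nth_cat size_nseq b0 nth_nseq b0.
  by split; rewrite // ltnW.
rewrite gtn_eqF //= subSn //.
by apply: IH; rewrite ?(path_sorted sj) // -?subSn // leq_subLR.
Qed.

(** * Biwords, their monomials and their order *)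

Section Biwords.
Variable m : nat.
Implicit Types z : seq ('I_m * nat).

Definition biword_monomial z : {cmonom (mvar m)} :=
  \big[mmul/mone]_(p <- z) ucm (p : mvar m).

Lemma biword_monomialE z p : biword_monomial z p = count_mem p z.
Proof.
rewrite /biword_monomial; elim: z => [|q z IH]; first by rewrite big_nil cm1.
by rewrite big_cons cmM cmU IH.
Qed.

Lemma mdeg_biword_monomial z : mdeg (biword_monomial z) = size z.
Proof.
by rewrite mdeg_prod -sum1_size; apply: eq_bigr => p _; rewrite mdegU.
Qed.

Lemma biword_monomial_perm z z' :
  biword_monomial z = biword_monomial z' -> perm_eq z z'.
Proof.
by move=> eq_zz'; apply/allP => p _; rewrite /= -!biword_monomialE eq_zz'.
Qed.

(** Lexicographic, index before row. Transitivity and antisymmetry leave a multiset at most one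
    sorted arrangement, so a sorted biword is determined by its monomial. *)
Definition biletter_le : rel ('I_m * nat) :=
  fun p q => (p.2 < q.2) || (p.2 == q.2) && (p.1 <= q.1).

Lemma biletter_le_trans : transitive biletter_le.
Proof.
move=> [b y] [a x] [c z]; rewrite /biletter_le /=.
case/orP=> [xy|/andP[/eqP-> ab]] /orP[yz|/andP[/eqP<- bc]].
- by rewrite (ltn_trans xy yz).
- by rewrite xy.
- by rewrite yz.
- by rewrite eqxx (leq_trans ab bc) orbT.
Qed.

Lemma biletter_le_anti : antisymmetric biletter_le.
Proof.
move=> [a x] [b y]; rewrite /biletter_le /= eq_sym.
have [xy|yx|->] //= := ltngtP x y.
by rewrite -eqn_leq => /eqP/val_inj->.
Qed.

End Biwords.

(** * Column words, and both kinds of monomials as biwords *)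

Section ColumnWords.
Variable m : nat.
Implicit Types c d : mcomp m.

Definition colword c (i : 'I_(mlen c)) : seq 'I_m :=
  flatten [seq nseq (mmx c q i) q | q <- enum 'I_m].

Definition colwords c : seq (seq 'I_m) :=
  [seq colword i | i <- enum 'I_(mlen c)].

Lemma count_colword c (i : 'I_(mlen c)) q : count_mem q (colword i) = mmx c q i.
Proof.
rewrite count_flatten -map_comp sumnE big_map big_enum (bigD1 q) //=.
rewrite count_nseq /= eqxx mul1n big1 ?addn0 // => r rq.
by rewrite count_nseq /= (negbTE rq).
Qed.

Lemma size_colword c (i : 'I_(mlen c)) : size (colword i) = colwt i.
Proof.
rewrite size_flatten /shape -map_comp sumnE big_map big_enum /=.
by apply: eq_bigr => q _; rewrite size_nseq.
Qed.

Lemma colword_sorted c (i : 'I_(mlen c)) :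
  sorted (relpre val leq) (colword i).
Proof.
rewrite /colword; have : sorted (relpre val ltn) (enum 'I_m).
  by rewrite -sorted_map val_enum_ord iota_ltn_sorted.
have letr : transitive (relpre (val : 'I_m -> nat) leq).
  by move=> y x z; apply: leq_trans.
have lttr : transitive (relpre (val : 'I_m -> nat) ltn).
  by move=> y x z; apply: ltn_trans.
elim: (enum _) => [|q s IH] //; rewrite /= path_sortedE // => /andP[/allP qs].
move/IH; rewrite !sorted_pairwise // pairwise_cat => -> /=; rewrite andbT.
apply/andP; split; last first.
  by elim: (mmx c q i) => [|n IHn] //=; rewrite IHn all_nseq /= leqnn orbT.
apply/allrelP => x y /nseqP[-> _] /flattenP[_ /mapP[r rs ->] /nseqP[-> _]].
exact/ltnW/qs.
Qed.

Lemma colwt_gt0 c (i : 'I_(mlen c)) : 0 < colwt i.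
Proof.
rewrite lt0n; apply: contraTneq (forallP (valP c) i) => ci0; rewrite negbK.
apply/eqP/matrixP => q ?; rewrite !mxE.
by move/eqP: ci0; rewrite sum_nat_eq0 => /forallP/(_ q)/eqP.
Qed.

Lemma size_colwords c : size (colwords c) = mlen c.
Proof. by rewrite size_map size_enum_ord. Qed.

Lemma shape_colwords c :
  shape (colwords c) = [seq colwt i | i <- enum 'I_(mlen c)].
Proof.
by rewrite /shape -map_comp; apply: eq_map => i /=; rewrite size_colword.
Qed.

Lemma shape_colwords_gt0 c : all (ltn 0) (shape (colwords c)).
Proof.
by rewrite shape_colwords all_map; apply/allP => i _ /=; apply: colwt_gt0.
Qed.

(** Counting the letter [q] in the [i]-th word recovers the matrix entry. *)
Lemma colwords_inj : injective colwords.
Proof.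
move=> c d eq_cd; have eq_l : mlen c = mlen d.
  by rewrite -!size_colwords eq_cd.
case: c d eq_l eq_cd => [[l A] nzA] [[l' B] nzB] /= eq_l.
rewrite /mlen /= in eq_l; subst l' => eq_AB; apply: val_inj; congr existT.
apply/matrixP => q i.
have /eq_in_map/(_ i) := eq_AB; rewrite mem_enum => /(_ isT) eq_i.
by have := congr1 (count_mem q) eq_i; rewrite !count_colword.
Qed.

Lemma sumn_take_map_ord n (F : 'I_n -> nat) r : r <= n ->
  sumn (take r [seq F i | i <- enum 'I_n]) = \sum_(i < n | i < r) F i.
Proof.
move=> rn; rewrite -map_take sumnE big_map.
transitivity (\sum_(i <- enum 'I_n | i < r) F i); last by rewrite big_enum_cond.
rewrite -[in RHS](cat_take_drop r (enum 'I_n)) big_cat /=.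
rewrite [X in _ + X]big1_seq ?addn0.
  rewrite [RHS]big_seq_cond [LHS]big_seq; apply: eq_bigl => i.
  case: (boolP (i \in _)) => //= /(map_f val); rewrite map_take val_enum_ord.
  by rewrite take_iota mem_iota /= (minn_idPl rn) => ->.
move=> i /andP[ir /(map_f val)]; rewrite map_drop val_enum_ord drop_iota add0n.
by rewrite mem_iota leqNgt ir.
Qed.

Lemma SN_cuts c : SN c = cuts (shape (colwords c)).
Proof.
rewrite shape_colwords /cuts size_map size_enum_ord; apply/eq_in_map => r.
rewrite mem_iota add1n ltnS => /andP[_ rl].
by rewrite sumn_take_map_ord // (leq_trans rl) ?leq_pred.
Qed.

Lemma sumn_shape_colwords c : sumn (shape (colwords c)) = mwt c.
Proof. by rewrite shape_colwords sumnE big_map big_enum. Qed.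

Lemma mlen_le_mwt c : mlen c <= mwt c.
Proof.
rewrite -[X in X <= _]card_ord -sum1_card; apply: leq_sum => i _.
exact: colwt_gt0.
Qed.

Lemma fundamental_monomialE c (i : (mwt c).-tuple nat) :
  fundamental_monomial i = biword_monomial (zip (gword c) i).
Proof.
have sz : size (gword c) = size i by rewrite (eqP (size_gword c)) size_tuple.
(* Weight zero is separate: [big_nth] needs a default letter in ['I_m], which is otherwise taken
   from the nonempty [gword c]. *)
rewrite /biword_monomial; case: (posnP (mwt c)) => [c0|c0].
  rewrite /fundamental_monomial big1 => [|j]; last first.
    by exfalso; have := leq_ltn_trans (leq0n j) (ltn_ord j); rewrite c0.
  rewrite [zip _ _]size0nil ?big_nil // size_zip -sz minnn.
  by rewrite (eqP (size_gword c)).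
have q0 : 'I_m by case: (gword c) (eqP (size_gword c)) c0 => [<-|].
rewrite (big_nth (q0, 0)) size_zip -sz minnn (eqP (size_gword c)) big_mkord.
apply: eq_bigr => j _.
by rewrite nth_zip // /g (tnth_nth q0) /= (tnth_nth 0).
Qed.

Definition spread_columns c (j : seq nat) : seq nat :=
  spread (shape (colwords c)) j.

Lemma size_spread_columns c (j : (mlen c).-tuple nat) :
  size (spread_columns c j) == mwt c.
Proof.
rewrite size_spread ?sumn_shape_colwords //.
by rewrite size_map size_colwords size_tuple.
Qed.

Lemma expcmnE (I : choiceType) (u : {cmonom I}) n p : expcmn u n p = n * u p.
Proof.
rewrite /expcmn; elim: n => [|[|n] IH]; rewrite ?cm1 ?mul1n //.
by rewrite [LHS]cmM [X in _ + X]IH mulSn.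
Qed.

Lemma cmonom_prodE (I J : choiceType) (s : seq J) (F : J -> {cmonom I}) p :
  (\big[mmul/mone]_(i <- s) F i) p = \sum_(i <- s) F i p.
Proof.
elim: s => [|i s IH]; first by rewrite !big_nil cm1.
by rewrite !big_cons cmM IH.
Qed.

Lemma xpowE (w : 'cV[nat]_m) j p : xpow w j p = (j == p.2) * w p.1 ord0.
Proof.
case: p => q n; rewrite /xpow cmonom_prodE (bigD1 q) //= big1 => [|r rq].
  by rewrite expcmnE cmU xpair_eqE eqxx /= addn0 mulnC.
by rewrite expcmnE cmU xpair_eqE (negbTE rq) muln0.
Qed.

Lemma mcomp_monomial_coef c (j : (mlen c).-tuple nat) p :
  mcomp_monomial j p = \sum_(s < mlen c) (tnth j s == p.2) * mmx c p.1 s.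
Proof.
rewrite cmonom_prodE; apply: eq_bigr => s _.
by rewrite xpowE mxE.
Qed.

Lemma zip_flatten_nseq (T I U : Type) (s : seq I) (w : I -> seq T)
    (t : I -> U) :
  zip (flatten [seq w i | i <- s])
      (flatten [seq nseq (size (w i)) (t i) | i <- s])
  = flatten [seq [seq (x, t i) | x <- w i] | i <- s].
Proof.
elim: s => //= i s IH; rewrite zip_cat ?size_nseq // IH; congr (_ ++ _).
by elim: (w i) => //= x v ->.
Qed.

(** Exponents are compared variable by variable: both sides count the letters [q] in the columns
    placed at index [n]. *)
Lemma mcomp_monomialE c (j : (mlen c).-tuple nat) :
  mcomp_monomial j = biword_monomial (zip (gword c) (spread_columns c j)).
Proof.
apply/eqP/cmP => -[q n]; rewrite mcomp_monomial_coef biword_monomialE.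
rewrite /spread_columns /spread shape_colwords -(map_tnth_enum j) zip_map.
rewrite -map_comp.
rewrite (eq_map (_ : _ =1 fun i => nseq (size (colword i)) (tnth j i)));
  last by move=> i; rewrite /= size_colword.
rewrite zip_flatten_nseq count_flatten -map_comp sumnE big_map big_enum.
apply: eq_bigr => s _; rewrite /= count_map -count_colword.
rewrite [RHS](eq_count (_ : _ =1 predI (pred1 q) (fun=> tnth j s == n))).
  case: eqP => _; rewrite ?mul1n ?mul0n -?(count_pred0 (colword s)).
    by apply: eq_count => x; rewrite /= andbT.
  by apply: eq_count => x; rewrite /= andbF.
by move=> x; rewrite /= xpair_eqE.
Qed.

End ColumnWords.

(** * Refinement of multi-compositions, and equality of monomials *)

Section Refinement.
Variable m : nat.
Implicit Types c d : mcomp m.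

(** [d] cuts the same row word at all the places where [c] does, and possibly more. *)
Definition refines c d : bool :=
  (gword c == gword d) && all (mem (SN d)) (SN c).

Lemma refines_refl c : refines c c.
Proof. by rewrite /refines eqxx; apply/allP. Qed.

Lemma refines_mwt c d : refines c d -> mwt c = mwt d.
Proof.
by case/andP=> /eqP cd _; rewrite -(eqP (size_gword c)) cd (eqP (size_gword d)).
Qed.

Lemma refines_mlen c d : refines c d -> mlen c <= mlen d.
Proof.
move=> cd; have eq_wt := refines_mwt cd.
case/andP: cd => _ /allP; rewrite !SN_cuts.
move/(cuts_subset_size (shape_colwords_gt0 c)).
rewrite [size (shape _)]size_map [size (shape _)]size_map !size_colwords.
move=> le_len.
(* The bound on predecessors does not separate lengths 0 and 1; for empty [d] the common weight is
   0, which bounds [mlen c]. *)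
have [d0|d0] := posnP (mlen d); last first.
  by rewrite -(prednK d0) (leq_trans (leqSpred _)).
suff : mwt d = 0 by rewrite -eq_wt d0 => <-; apply: mlen_le_mwt.
by rewrite -sumn_shape_colwords [colwords d]size0nil // size_colwords.
Qed.

(** Equal lengths turn the inclusion of cuts into equality, so the common word splits into the same
    column words. *)
Lemma refines_eq c d : refines c d -> mlen c = mlen d -> c = d.
Proof.
move=> cd eq_len; have eq_wt := refines_mwt cd.
case/andP: cd => /eqP eq_w /allP; rewrite !SN_cuts => sub.
apply: colwords_inj; apply: eq_from_flatten_shape eq_w _.
apply: cuts_subset_eq sub; rewrite ?shape_colwords_gt0 ?sumn_shape_colwords //.
by rewrite [LHS]size_map [RHS]size_map !size_colwords.
Qed.

(** The spread word rises exactly at [SN d], so the strict inequalities required at [SN c] amount to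
    inclusion. *)
Lemma spread_columns_indices c d (j : (mlen d).-tuple nat)
    (i : (mwt c).-tuple nat) : sorted ltn j -> gword c = gword d ->
  tval i = spread_columns d j ->
  fundamental_indices c i <-> refines c d.
Proof.
move=> sj eq_w eq_i.
rewrite /refines eq_w eqxx /fundamental_indices /mkset /= eq_i.
have eq_wt : mwt c = mwt d.
  by rewrite -(eqP (size_gword c)) eq_w (eqP (size_gword d)).
have step r : 0 < r < mwt c ->
    (nth 0 (spread_columns d j) r.-1 <= nth 0 (spread_columns d j) r) /\
    (nth 0 (spread_columns d j) r.-1 < nth 0 (spread_columns d j) r)
      = (r \in SN d).
  case: r => // r rlt; rewrite SN_cuts; apply: spread_step => //.
  - exact: shape_colwords_gt0.
  - by rewrite [LHS]size_map size_colwords size_tuple.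
  - by rewrite sumn_shape_colwords -eq_wt.
split=> [ci|/allP sub r rlt].
  apply/allP => r rc /=; have rlt : 0 < r < mwt c.
    rewrite -sumn_shape_colwords cuts_range ?shape_colwords_gt0 //.
    by rewrite -SN_cuts.
  by have [_ /= <-] := step r rlt; have [_ ->] := ci r rlt.
by have [-> ->] := step r rlt; split=> // /sub.
Qed.

(** Where the index does not rise, the position is outside [SN c], so both letters lie in one
    column, whose word is sorted. *)
Lemma fundamental_indices_sorted c (i : (mwt c).-tuple nat) :
  fundamental_indices c i -> sorted (@biletter_le m) (zip (gword c) i).
Proof.
move=> ci; have sz := eqP (size_gword c).
case E : (gword c) => [|q0 w]; first by case: (tval i).
rewrite -E; apply/(sortedP (q0, 0)) => r.
rewrite size_zip sz size_tuple minnn => rlt.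
rewrite !nth_zip ?sz ?size_tuple //.
have [] := ci r.+1 rlt; rewrite /biletter_le /= leq_eqVlt.
case/predU1P=> [<-|-> //]; rewrite eqxx /= ltnn => notSN.
apply: (@flatten_step _ (relpre val leq) q0 (colwords c)).
- by apply/allP => _ /mapP[s _ ->]; apply: colword_sorted.
- by rewrite -/(gword c) sz.
- by rewrite -SN_cuts; apply/negP => /notSN.
Qed.

Lemma fundamental_monomial_eq c d (i : (mwt c).-tuple nat)
    (j : (mlen d).-tuple nat) : sorted ltn j -> fundamental_indices c i ->
  fundamental_monomial i = mcomp_monomial j ->
  gword c = gword d /\ tval i = spread_columns d j.
Proof.
move=> sj ci; rewrite fundamental_monomialE mcomp_monomialE.
move/biword_monomial_perm => eq_ij.
have szd : size (gword d) = size (spread_columns d j).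
  by rewrite (eqP (size_gword d)) (eqP (size_spread_columns j)).
have szc : size (gword c) = size i by rewrite (eqP (size_gword c)) size_tuple.
pose j' := Tuple (size_spread_columns j).
(* By reflexivity of [refines], the placement of [d] is itself a term of its own fundamental
   function, so its biword is sorted too. *)
have dj : fundamental_indices d j'.
  by apply/(spread_columns_indices sj) => //; apply: refines_refl.
have /= eq_z := sorted_eq (@biletter_le_trans m) (@biletter_le_anti m)
  (fundamental_indices_sorted ci) (fundamental_indices_sorted dj) eq_ij.
by split; [have := congr1 unzip1 eq_z; rewrite !unzip1_zip ?szc ?szd
          |have := congr1 unzip2 eq_z; rewrite !unzip2_zip ?szc ?szd].
Qed.

(** The occurring indices in increasing order give the placement; the exponents at each one form a
    column, nonzero because the index occurs. *)
Lemma mcomp_monomial_surj (u : {cmonom (mvar m)}) :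
  exists c (j : (mlen c).-tuple nat), sorted ltn j /\ mcomp_monomial j = u.
Proof.
pose js := sort leq (undup [seq p.2 | p <- finsupp u]).
have mem_js p : u p != 0 -> p.2 \in js.
  by move=> up; rewrite mem_sort mem_undup map_f // mem_finsupp.
have uniq_js : uniq js by rewrite sort_uniq undup_uniq.
pose A := (\matrix_(q < m, s < size js) u (q, nth 0%N js s))%R.
have nzA : nonzero_columns (Tagged (fun l => 'M[nat]_(m, l)) A).
  apply/forallP => s /=.
  have : nth 0 js s \in js by rewrite mem_nth.
  rewrite mem_sort mem_undup => /mapP[[q n]].
  rewrite mem_finsupp => uqn /= eq_n.
  apply: contraNneq uqn => /matrixP/(_ q ord0); rewrite !mxE eq_n => ->.
  by [].
exists (MComp nzA), (in_tuple js); split.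
  by rewrite ltn_sorted_uniq_leq uniq_js sort_sorted //; apply: leq_total.
apply/eqP/cmP => -[q n]; rewrite mcomp_monomial_coef /=.
have E (s : 'I_(size js)) : tnth (in_tuple js) s = nth 0 js s.
  by rewrite (tnth_nth 0).
have [n_js|n_js] := boolP (n \in js).
  have lt_n : index n js < size js by rewrite index_mem.
  rewrite (bigD1 (Ordinal lt_n)) //= E mxE /= nth_index // eqxx mul1n.
  rewrite big1 ?addn0 // => s ne_s; rewrite E.
  case: eqP => // eq_n; case/eqP: ne_s; apply: val_inj => /=.
  by rewrite -eq_n index_uniq.
rewrite big1 => [|s _]; last first.
  by rewrite E; case: eqP => // eq_n; rewrite -eq_n mem_nth in n_js.
by apply/esym/eqP; apply: contraNT n_js => /mem_js.
Qed.

Lemma mdeg_mcomp_monomial c (j : (mlen c).-tuple nat) :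
  mdeg (mcomp_monomial j) = mwt c.
Proof.
rewrite mcomp_monomialE mdeg_biword_monomial size_zip.
by rewrite (eqP (size_gword c)) (eqP (size_spread_columns j)) minnn.
Qed.

Lemma mdeg_fundamental_monomial c (i : (mwt c).-tuple nat) :
  mdeg (fundamental_monomial i) = mwt c.
Proof.
rewrite fundamental_monomialE mdeg_biword_monomial size_zip.
by rewrite (eqP (size_gword c)) size_tuple minnn.
Qed.

(** The weight bounds each entry and, columns being nonzero, the number of columns; finitely many
    matrices over ['I_D.+1] suffice. *)
Lemma finitely_many_mcomp_mwt D :
  exists2 s : seq (mcomp m), uniq s & forall c, (c \in s) = (mwt c <= D).
Proof.
pose M : seq {l : nat & 'M[nat]_(m, l)} :=
  [seq Tagged (fun l => 'M[nat]_(m, l)) (map_mx val A) |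
    l <- iota 0 D.+1, A <- enum {: 'M['I_D.+1]_(m, l)}].
exists [seq c <- undup (pmap insub M) | mwt c <= D].
  by rewrite filter_uniq ?undup_uniq.
move=> c; rewrite mem_filter mem_undup mem_pmap_sub andb_idr // => cD.
have le_entry q s : mmx c q s <= D.
  apply: leq_trans cD; rewrite /mwt (bigD1 s) //= /colwt (bigD1 q) //=.
  by rewrite -addnA leq_addr.
apply/allpairsPdep; exists (mlen c), (map_mx inord (mmx c)); split.
- by rewrite mem_iota ltnS (leq_trans (mlen_le_mwt c)).
- by rewrite mem_enum.
case: c cD le_entry => [[l A] nzA] /= cD le_entry; congr existT.
by apply/matrixP => q s; rewrite !mxE inordK // ltnS.
Qed.

End Refinement.

Local Open Scope ring_scope.

(** * The unitriangular coefficient matrix, freeness and spanning *)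

Section Basis.
Variables (k : comNzRingType) (m : nat).
Implicit Types (c d : mcomp m) (v : pseries k (mvar m)).

Lemma pseries_sumE (X : choiceType) (I : Type) (s : seq I) (a : I -> k)
    (F : I -> pseries k X) u :
  (\sum_(i <- s) a i *: F i) u = \sum_(i <- s) a i * F i u.
Proof.
elim: s => [|i s IH]; first by rewrite !big_nil.
by rewrite !big_cons -IH.
Qed.

(** Only the index sequence [spread_columns d j] can contribute, and it is admissible exactly when
    [refines c d]. *)
Lemma fundamental_coef c d (j : (mlen d).-tuple nat) : sorted ltn j ->
  fundamental k c (mcomp_monomial j) = (refines c d)%:R.
Proof.
move=> sj; rewrite /fundamental; have [cd|ncd] := boolP (refines c d).
  have szi : size (spread_columns d j) == mwt c.
    by rewrite (refines_mwt cd) size_spread_columns.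
  pose i := Tuple szi; have /andP[/eqP eq_w _] := cd.
  rewrite -(@fsbig_widen _ _ _ _ [set i]%classic).
  - rewrite fsbig_set1 /monomial_series.
    by rewrite fundamental_monomialE mcomp_monomialE /= eq_w eqxx.
  - by move=> _ ->; apply/(spread_columns_indices sj).
  move=> i' /= [ci' ne_i']; rewrite /monomial_series.
  case: eqP => // /esym/(fundamental_monomial_eq sj ci')[_ eq_i'].
  by case: ne_i'; apply: val_inj.
rewrite fsbig1 // => i ci; rewrite /monomial_series.
case: eqP => // /esym/(fundamental_monomial_eq sj ci)[eq_w eq_i].
by case/negP: ncd; apply/(spread_columns_indices sj eq_w eq_i).
Qed.

Lemma fundamental_mdeg c u : mdeg u != mwt c -> fundamental k c u = 0.
Proof.
move=> uc; rewrite /fundamental fsbig1 // => i _; rewrite /monomial_series.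
by move: uc; have [->|] // := eqVneq u; rewrite mdeg_fundamental_monomial eqxx.
Qed.

Lemma fundamental_MQSym c : fundamental k c \in MQSym k m.
Proof.
apply/asboolP; split=> [|w j j' sj sj']; last by rewrite !fundamental_coef.
by exists (mwt c) => u cu; rewrite fundamental_mdeg // gtn_eqF.
Qed.

(** The leftmost placement represents all increasing ones when [v] is multi-quasisymmetric. *)
Definition mcoef v c : k := v (mcomp_monomial (iota_tuple (mlen c) 0)).

Lemma mcoef_fundamental c d : mcoef (fundamental k c) d = (refines c d)%:R.
Proof. by rewrite /mcoef fundamental_coef ?iota_ltn_sorted. Qed.

Lemma mcoef_sum (s : seq (mcomp m)) (a : mcomp m -> k) d :
  mcoef (\sum_(c <- s) a c *: fundamental k c) d
  = \sum_(c <- s) a c *+ refines c d.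
Proof.
rewrite /mcoef pseries_sumE; apply: eq_bigr => c _.
by rewrite -/(mcoef _ d) mcoef_fundamental mulr_natr.
Qed.

Lemma MQSym_eq0 v : v \in MQSym k m -> (forall c, mcoef v c = 0) -> v = 0.
Proof.
move=> /asboolP[_ qv] v0; apply/funext => u.
have [c [j [sj <-]]] := mcomp_monomial_surj u.
rewrite (qv c j (iota_tuple (mlen c) 0)) ?iota_ltn_sorted //.
by rewrite -/(mcoef v c) v0.
Qed.

(** Strong induction on [mlen d]: in the coefficient at [d], every other contributing [c] has fewer
    columns, so [a c] already vanishes. *)
Lemma fundamental_free (s : seq (mcomp m)) (a : mcomp m -> k) : uniq s ->
  \sum_(c <- s) a c *: fundamental k c = 0 -> {in s, forall c, a c = 0}.
Proof.
move=> us s0 d; have [n] := ubnP (mlen d); elim: n d => // n IH d /ltnSE dn ds.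
have : mcoef (\sum_(c <- s) a c *: fundamental k c) d = 0 by rewrite s0.
rewrite mcoef_sum (bigD1_seq d) //= refines_refl big1_seq ?addr0 //.
move=> c /andP[ne_cd cs]; have [cd|//] := boolP (refines c d).
apply: IH => //; apply: leq_trans dn.
rewrite ltn_neqAle refines_mlen // andbT.
by apply: contra_neq ne_cd; apply: refines_eq.
Qed.

(** [t] counts the lengths up to [D] still to be cleared; each step subtracts a combination that
    kills the coefficients at the shortest remaining length. *)
Lemma fundamental_span_mlen D (s : seq (mcomp m)) t v : uniq s ->
    (forall c, (c \in s) = (mwt c <= D)%N) ->
    v \in MQSym k m -> (forall u, (D < mdeg u)%N -> v u = 0) ->
    (forall c, (mlen c + t <= D)%N -> mcoef v c = 0) ->
  exists a : mcomp m -> k, v = \sum_(c <- s) a c *: fundamental k c.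
Proof.
move=> us sP; elim: t v => [|t IH] v vQ vD v0.
  exists (fun=> 0); rewrite big1 => [|c _]; last exact: scale0r.
  (* Lengths up to [D] are cleared; a longer [c] has weight above the degree bound. *)
  apply: MQSym_eq0 => // c; have [cD|Dc] := leqP (mlen c) D.
    by rewrite v0 // addn0.
  by rewrite /mcoef vD // mdeg_mcomp_monomial (leq_trans Dc) ?mlen_le_mwt.
pose b c := if (mlen c + t == D)%N then mcoef v c else 0.
pose w : pseries k (mvar m) := \sum_(c <- s) b c *: fundamental k c.
have [||c ct|a va] := IH (v - w).
- apply: rpredB => //; apply: rpred_sum => c _.
  exact/rpredZ/fundamental_MQSym.
- move=> u Du; rewrite -[LHS]/(v u - w u) vD // /w pseries_sumE.
  rewrite big1_seq ?subr0 //.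
  move=> c /andP[_]; rewrite sP => cD.
  by rewrite fundamental_mdeg ?mulr0 // gtn_eqF // (leq_ltn_trans cD).
- rewrite -[LHS]/(mcoef v c - mcoef w c) mcoef_sum.
  (* A nonzero [b d] puts [d] at length [D - t], at least that of [c], while refinement gives the
     reverse inequality; equal lengths would force [d = c]. *)
  have b0 d : d != c -> b d *+ refines d c = 0.
    move=> ne_dc; have [dc|//] := boolP (refines d c).
    rewrite /b; case: eqP => // dt; case/eqP: ne_dc.
    apply: (refines_eq dc); apply/eqP; rewrite eqn_leq refines_mlen //=.
    by rewrite -(leq_add2r t) dt.
  have [cs|cNs] := boolP (c \in s); last first.
    rewrite big1_seq ?subr0 => [|d /andP[_ ds]].
      by rewrite /mcoef vD // mdeg_mcomp_monomial ltnNge -sP.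
    by rewrite b0 //; apply: contraNneq cNs => <-.
  rewrite (bigD1_seq c) //= refines_refl big1 ?addr0 => [|d ne_dc];
    last exact: b0.
  rewrite /b; case: eqP => [_|/eqP ct']; first exact: subrr.
  by rewrite subr0 v0 // addnS ltn_neqAle ct'.
exists (fun c => a c + b c).
rewrite -[LHS](subrK w) va -big_split; apply: eq_bigr => c _ /=.
by rewrite scalerDl.
Qed.

Lemma fundamental_span v : v \in MQSym k m ->
  exists (s : seq (mcomp m)) (a : mcomp m -> k),
    v = \sum_(c <- s) a c *: fundamental k c.
Proof.
move=> vQ; have /asboolP[[D vD] _] := vQ.
have [s us sP] := finitely_many_mcomp_mwt m D.
(* Lengths run from 0 to [D], so starting at [D.+1] makes the vanishing hypothesis vacuous. *)
exists s; apply: (@fundamental_span_mlen D s D.+1) => // c.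
by rewrite addnS ltnNge leq_addl.
Qed.

End Basis.

Theorem proposition2p22 (k : comNzRingType) (phi : {rmorphism rat -> k})
    (m : nat) (hm : (0 < m)%N) :
  is_basis (MQSym k m) (fundamental k (m := m)).
Proof.
split; [exact: fundamental_MQSym | exact: fundamental_free |].
exact: fundamental_span.
Qed.
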